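(* Let $G$ be a simply connected semisimple algebraic group over an algebraically closed field $k$ of characteristic $p$, and let $\lambda$ be a dominant weight. Let $I(\lambda)$ be the rationally injective $G$-envelope of the simple $G$-module $L(\lambda)$ of highest weight $\lambda$. Suppose $I(\lambda)=\varinjlim_i X_i$, where the $X_i$ are finite-dimensional $G$-modules. Then $P(\lambda^* )$, the $k[G]$-Contra projective cover of $L(\lambda)^*$, the dual module of $L(\lambda)$, is isomorphic to $\varprojlim_i X_i^*$ as contramodules.
   Context: $G$-modules are rational left $G$-modules, equivalently right $k[G]$-comodules; $I(\lambda)$ is the injective envelope of $L(\lambda)$ in the category of rational $G$-modules, and the direct limit is a direct limit of a direct system of $G$-modules. Left contramodules. Duals are not converted from right to left by the inverse, so here contramodules are left contramodules. Let $(C,\Delta,\epsilon)$ be a coalgebra over $k$. A left $C$-contramodule is a $k$-vector space $B$ with a linear map $\theta_B:\mathrm{Hom}_k(C,B)\to B$ such that the two maps $\mathrm{Hom}_k(C,\mathrm{Hom}_k(C,B))\to B$ given by $\theta_B\circ\mathrm{Hom}_k(C,\theta_B)$ and by $\theta_B\circ\mathrm{Hom}_k(\Delta,B)$ after the identification $\mathrm{Hom}_k(C,\mathrm{Hom}_k(C,B))\cong\mathrm{Hom}_k(C\otimes C,B)$, $F\mapsto(d\otimes c\mapsto F(c)(d))$, coincide, and $\theta_B(c\mapsto\epsilon(c)b)=b$ for all $b\in B$. A homomorphism $B\to D$ is a linear map $f$ with $f\circ\theta_B=\theta_D\circ\mathrm{Hom}_k(C,f)$. For a right $C$-comodule $(M,\Delta_M)$,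 the dual $M^*=\mathrm{Hom}_k(M,k)$ is a left $C$-contramodule via $\mathrm{Hom}_k(C,\mathrm{Hom}_k(M,k))\cong\mathrm{Hom}_k(M\otimes C,k)\to\mathrm{Hom}_k(M,k)$, the last map being $\mathrm{Hom}_k(\Delta_M,k)$. This is the structure on $L(\lambda)^*$ and on each $X_i^*$; the transition maps of the inverse system $(X_i^* )$ are the duals of those of $(X_i)$, and the inverse limit is taken in the category of left $k[G]$-contramodules. A projective cover of an object $M$ is a pair $(P,\phi)$ with $P$ projective and $\phi:P\to M$ a superfluous epimorphism, i.e. any subobject $H\subseteq P$ with $H+\ker(\phi)=P$ equals $P$. *)

(* Defs.v *)
From HB Require Import structures.
From mathcomp Require Import all_boot all_order all_algebra.
From mathcomp Require Import boolp classical_sets.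
From mathcomp Require Import mpoly.

Set Implicit Arguments.
Unset Strict Implicit.
Unset Printing Implicit Defensive.

Import GRing.Theory.

Local Open Scope ring_scope.
Local Open Scope quotient_scope.
Local Open Scope classical_set_scope.

Section Hom.
Variables (k : fieldType) (U V : lmodType k).

Definition hom : Type := {linear U -> V}.

Lemma homP (f g : hom) : f =1 g -> f = g.
Proof.
case: f g => [f [[[f0 fD]] [fZ]]] [g [[[g0 gD]] [gZ]]] /= /funext fg.
rewrite -{}fg in g0 gD gZ *.
by rewrite (Prop_irrelevance f0 g0) (Prop_irrelevance fD gD)
  (Prop_irrelevance fZ gZ).
Qed.

HB.instance Definition _ := gen_eqMixin hom.
HB.instance Definition _ := gen_choiceMixin hom.

Definition hom_zero : hom := \0.
Definition hom_add (f g : hom) : hom := f \+ g.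
Definition hom_opp (f : hom) : hom := \- f.
Definition hom_scale (a : k) (f : hom) : hom := a \*: f.

Fact hom_addA : associative hom_add.
Proof. by move=> f g h; apply: homP => u /=; rewrite addrA. Qed.
Fact hom_addC : commutative hom_add.
Proof. by move=> f g; apply: homP => u /=; rewrite addrC. Qed.
Fact hom_add0 : left_id hom_zero hom_add.
Proof. by move=> f; apply: homP => u /=; rewrite add0r. Qed.
Fact hom_addN : left_inverse hom_zero hom_opp hom_add.
Proof. by move=> f; apply: homP => u /=; rewrite addNr. Qed.

HB.instance Definition _ :=
  GRing.isZmodule.Build hom hom_addA hom_addC hom_add0 hom_addN.

Fact hom_scaleA a b f : hom_scale a (hom_scale b f) = hom_scale (a * b) f.
Proof. by apply: homP => u /=; rewrite scalerA. Qed.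
Fact hom_scale1 : left_id 1 hom_scale.
Proof. by move=> f; apply: homP => u /=; rewrite scale1r. Qed.
Fact hom_scaleDr : right_distributive hom_scale +%R.
Proof. by move=> a f g; apply: homP => u /=; rewrite scalerDr. Qed.
Fact hom_scaleDl f : {morph hom_scale^~ f : a b / a + b}.
Proof. by move=> a b; apply: homP => u /=; rewrite scalerDl. Qed.

HB.instance Definition _ := GRing.Zmodule_isLmodule.Build k hom
  hom_scaleA hom_scale1 hom_scaleDr hom_scaleDl.

Lemma homDE (f g : hom) u : (f + g) u = f u + g u. Proof. by []. Qed.
Lemma homZE a (f : hom) u : (a *: f) u = a *: f u. Proof. by []. Qed.
Lemma hom_sumE (I : Type) (s : seq I) (F : I -> hom) u :
  (\sum_(i <- s) F i) u = \sum_(i <- s) F i u.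
Proof.
elim: s => [|i s IH]; first by rewrite !big_nil.
by rewrite !big_cons homDE IH.
Qed.
End Hom.

Section Tensor.
Variables (k : fieldType) (U V : lmodType k).

Definition bil_sum (W : lmodType k) (b : U -> V -> W) (s : seq (U * V)) : W :=
  \sum_(p <- s) b p.1 p.2.

(* U (x) V is the quotient of the finite formal sums of pairs (u, v) by the
   relation "every bilinear map takes the same value on both sums"; see
   [tensor_universal]. *)
Definition tensor_eqv (s t : seq (U * V)) : bool :=
  `[< forall (W : lmodType k) (b : {bilinear U -> V -> W}),
        bil_sum b s = bil_sum b t >].

Fact tensor_eqv_equiv : equiv_class_of tensor_eqv.
Proof.
split=> [s|s t|t s r].
- exact/asboolP.
- by apply/asboolP/asboolP => h W b; rewrite h.
- by move=> /asboolP h1 /asboolP h2; apply/asboolP => W b; rewrite h1 h2.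
Qed.

Canonical tensor_eqv_equivRel :=
  EquivRelPack tensor_eqv_equiv.

Definition tensor : Type := {eq_quot tensor_eqv}.
HB.instance Definition _ := Choice.on tensor.
HB.instance Definition _ := EqQuotient.on tensor.

Definition tens (u : U) (v : V) : tensor := \pi_tensor [:: (u, v)].

(* The linear map U (x) V -> W induced by b; only used for b bilinear. *)
Definition tlift (W : lmodType k) (b : U -> V -> W) (t : tensor) : W :=
  bil_sum b (repr t).

Lemma tlift_pi (W : lmodType k) (b : {bilinear U -> V -> W}) s :
  tlift b (\pi_tensor s) = bil_sum b s.
Proof.
rewrite /tlift; case: piP => t /eqmodP /= /asboolP h.
by rewrite h.
Qed.

Lemma tensor_ext (x y : tensor) :
  (forall (W : lmodType k) (b : {bilinear U -> V -> W}),
     tlift b x = tlift b y) -> x = y.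
Proof.
move=> h; rewrite -[x]reprK -[y]reprK.
by apply/eqmodP/asboolP => W b; apply: h.
Qed.

Definition tensor_zero : tensor := \pi_tensor [::].
Definition tensor_add (x y : tensor) : tensor := \pi_tensor (repr x ++ repr y).
Definition tensor_scale (a : k) (x : tensor) : tensor :=
  \pi_tensor [seq (a *: p.1, p.2) | p <- repr x].
Definition tensor_opp (x : tensor) : tensor := tensor_scale (-1) x.

Section LiftOps.
Variables (W : lmodType k) (b : {bilinear U -> V -> W}).

Fact tlift_zero : tlift b tensor_zero = 0.
Proof. by rewrite tlift_pi /bil_sum big_nil. Qed.
Fact tlift_add x y : tlift b (tensor_add x y) = tlift b x + tlift b y.
Proof. by rewrite tlift_pi /bil_sum big_cat. Qed.
Fact tlift_scale a x : tlift b (tensor_scale a x) = a *: tlift b x.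
Proof.
rewrite tlift_pi /tlift /bil_sum big_map scaler_sumr.
by apply: eq_bigr => p _ /=; rewrite linearZl_LR.
Qed.
Fact tlift_opp x : tlift b (tensor_opp x) = - tlift b x.
Proof. by rewrite tlift_scale scaleN1r. Qed.
End LiftOps.

Definition tliftE := (tlift_zero, tlift_add, tlift_scale, tlift_opp).

Fact tensor_addA : associative tensor_add.
Proof. by move=> x y z; apply: tensor_ext => W b; rewrite !tliftE addrA. Qed.
Fact tensor_addC : commutative tensor_add.
Proof. by move=> x y; apply: tensor_ext => W b; rewrite !tliftE addrC. Qed.
Fact tensor_add0 : left_id tensor_zero tensor_add.
Proof. by move=> x; apply: tensor_ext => W b; rewrite !tliftE add0r. Qed.
Fact tensor_addN : left_inverse tensor_zero tensor_opp tensor_add.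
Proof. by move=> x; apply: tensor_ext => W b; rewrite !tliftE addNr. Qed.

HB.instance Definition _ := GRing.isZmodule.Build tensor
  tensor_addA tensor_addC tensor_add0 tensor_addN.

Fact tensor_scaleA a b x :
  tensor_scale a (tensor_scale b x) = tensor_scale (a * b) x.
Proof. by apply: tensor_ext => W f; rewrite !tliftE scalerA. Qed.
Fact tensor_scale1 : left_id 1 tensor_scale.
Proof. by move=> x; apply: tensor_ext => W f; rewrite !tliftE scale1r. Qed.
Fact tensor_scaleDr : right_distributive tensor_scale +%R.
Proof.
by move=> a x y; apply: tensor_ext => W f; rewrite !tliftE scalerDr.
Qed.
Fact tensor_scaleDl x : {morph tensor_scale^~ x : a b / a + b}.
Proof.
by move=> a b; apply: tensor_ext => W f; rewrite !tliftE scalerDl.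
Qed.

HB.instance Definition _ := GRing.Zmodule_isLmodule.Build k tensor
  tensor_scaleA tensor_scale1 tensor_scaleDr tensor_scaleDl.

Fact tlift_linear (W : lmodType k) (b : {bilinear U -> V -> W}) :
  linear (tlift b).
Proof.
move=> a x y.
have -> : a *: x + y = tensor_add (tensor_scale a x) y by [].
by rewrite !tliftE.
Qed.

HB.instance Definition _ (W : lmodType k) (b : {bilinear U -> V -> W}) :=
  GRing.isLinear.Build k tensor W *:%R (tlift b) (tlift_linear b).

Lemma tlift_tens (W : lmodType k) (b : {bilinear U -> V -> W}) u v :
  tlift b (tens u v) = b u v.
Proof. by rewrite tlift_pi /bil_sum big_seq1. Qed.

Fact tens_bilinear : bilinear_for *:%R *:%R tens.
Proof.
split=> [v a u1 u2|u a v1 v2]; apply: tensor_ext => W b;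
  by rewrite linearP /= !tlift_tens ?linearPl ?linearPr.
Qed.

HB.instance Definition _ := bilinear_isBilinear.Build k U V tensor
  *:%R *:%R tens tens_bilinear.

Lemma tensorE (t : tensor) : t = \sum_(p <- repr t) tens p.1 p.2.
Proof.
apply: tensor_ext => W b; rewrite linear_sum /=.
by apply: eq_bigr => p _; rewrite tlift_tens.
Qed.

Lemma linear_tensorE (W : lmodType k) (h : {linear tensor -> W}) t :
  h t = \sum_(p <- repr t) h (tens p.1 p.2).
Proof. by rewrite [in LHS](tensorE t) linear_sum. Qed.

Lemma tensor_universal (W : lmodType k) (b : {bilinear U -> V -> W}) :
  (forall u v, tlift b (tens u v) = b u v) /\
  (forall h : {linear tensor -> W},
     (forall u v, h (tens u v) = b u v) -> h =1 tlift b).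
Proof.
split=> [u v|h hE t]; first exact: tlift_tens.
by rewrite linear_tensorE; apply: eq_bigr => p _.
Qed.
End Tensor.

Notation "U \ox V" := (tensor U V) (at level 40, left associativity).

Section TensorMaps.
Variables (k : fieldType).

Definition tmap (U V U' V' : lmodType k) (f : U -> U') (g : V -> V') :
    U \ox V -> U' \ox V' :=
  tlift (fun u v => tens (f u) (g v)).

Definition tassoc (U V W : lmodType k) : (U \ox V) \ox W -> U \ox (V \ox W) :=
  tlift (fun t w => tlift (fun u v => tens u (tens v w)) t).

Section TmapLinear.
Variables (U V U' V' : lmodType k).
Variables (f : {linear U -> U'}) (g : {linear V -> V'}).

Definition tmap_bil (u : U) (v : V) := tens (f u) (g v).

Fact tmap_bilinear : bilinear_for *:%R *:%R tmap_bil.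
Proof.
by split=> [v a u1 u2|u a v1 v2]; rewrite /tmap_bil linearP ?linearPl ?linearPr.
Qed.
HB.instance Definition _ := bilinear_isBilinear.Build k U V (U' \ox V')
  *:%R *:%R tmap_bil tmap_bilinear.

Fact tmap_linear : linear (tmap f g).
Proof. exact: (tlift_linear tmap_bil). Qed.
HB.instance Definition _ :=
  GRing.isLinear.Build k (U \ox V) (U' \ox V') *:%R (tmap f g) tmap_linear.

Lemma tmap_tens u v : tmap f g (tens u v) = tens (f u) (g v).
Proof. exact: (tlift_tens tmap_bil). Qed.
End TmapLinear.

(* The bilinear map b(u, v) = F(v)(u), for F in Hom(V, Hom(U, W)). *)
Section Uncurry.
Variables (U V W : lmodType k) (F : {linear V -> hom U W}).

Definition uncurry_bil (u : U) (v : V) : W := F v u.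

Fact uncurry_bilinear : bilinear_for *:%R *:%R uncurry_bil.
Proof.
by split=> [v a u1 u2|u a v1 v2]; rewrite /uncurry_bil linearP.
Qed.
HB.instance Definition _ := bilinear_isBilinear.Build k U V W
  *:%R *:%R uncurry_bil uncurry_bilinear.
End Uncurry.

Section Tassoc.
Variables (U V W : lmodType k).

Definition tassoc_bil1 (w : W) (u : U) (v : V) := tens u (tens v w).
Fact tassoc_bil1_bilinear w : bilinear_for *:%R *:%R (tassoc_bil1 w).
Proof.
by split=> [v a u1 u2|u a v1 v2];
  rewrite /tassoc_bil1 ?linearPl ?linearPr // linearPl linearPr.
Qed.
HB.instance Definition _ w := bilinear_isBilinear.Build k U V _
  *:%R *:%R (tassoc_bil1 w) (tassoc_bil1_bilinear w).

Definition tassoc_bil (t : U \ox V) (w : W) := tlift (tassoc_bil1 w) t.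
Fact tassoc_bilinear : bilinear_for *:%R *:%R tassoc_bil.
Proof.
split=> [w a t1 t2|t a w1 w2]; first by rewrite /tassoc_bil linearP.
rewrite /tassoc_bil /tlift /bil_sum /= scaler_sumr -big_split.
by apply: eq_bigr => p _ /=; rewrite /tassoc_bil1 !linearPr.
Qed.
HB.instance Definition _ := bilinear_isBilinear.Build k (U \ox V) W _
  *:%R *:%R tassoc_bil tassoc_bilinear.

Fact tassoc_linear : linear (@tassoc U V W).
Proof. exact: (tlift_linear tassoc_bil). Qed.
HB.instance Definition _ := GRing.isLinear.Build k _ _ *:%R
  (@tassoc U V W) tassoc_linear.

Lemma tassoc_tens (u : U) (v : V) (w : W) : tassoc (tens (tens u v) w) = tens u (tens v w).
Proof.
rewrite [LHS](tlift_tens tassoc_bil) /tassoc_bil.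
exact: (tlift_tens (tassoc_bil1 w)).
Qed.
End Tassoc.

(* Families of linear forms that separate the vectors of U and of V separate
   the vectors of U (x) V. *)
Section Separation.
Variables (U V : lmodType k) (X Y : Type).
Variables (phi : X -> {linear U -> k^o}) (psi : Y -> {linear V -> k^o}).

Definition form_bil (x : X) (y : Y) (u : U) (v : V) : k^o := phi x u * psi y v.
Fact form_bilinear x y : bilinear_for *:%R *:%R (form_bil x y).
Proof.
split=> [v a u1 u2|u a v1 v2]; rewrite /form_bil linearP.
  by rewrite mulrDl -mulrA.
by rewrite mulrDr mulrCA.
Qed.
HB.instance Definition _ x y := bilinear_isBilinear.Build k U V k^o
  *:%R *:%R (form_bil x y) (form_bilinear x y).

Hypothesis phi_sep : forall u, (forall x, phi x u = 0) -> u = 0.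
Hypothesis psi_sep : forall v, (forall y, psi y v = 0) -> v = 0.

Lemma tensor_sep (t : U \ox V) :
  (forall x y, tlift (form_bil x y) t = 0) -> t = 0.
Proof.
rewrite [t]tensorE; move: (repr t) => s; move: {2}(size s) (leqnn (size s)) => n.
elim: n s => [|n IH] [|[u v] s] //=; rewrite ?big_nil // ltnS => sn h.
have [u0|/existsNP [x /eqP xu]] := pselect (forall x, phi x u = 0).
  have uz := phi_sep u0; rewrite big_cons /= uz linear0l add0r.
  apply: IH => // x y; move: (h x y).
  by rewrite big_cons /= uz linear0l add0r.
have ve : v = - \sum_(p <- s) (phi x p.1 / phi x u) *: p.2.
  apply/eqP; rewrite -addr_eq0; apply/eqP.
  have sv : phi x u *: v + \sum_(p <- s) phi x p.1 *: p.2 = 0.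
    apply: psi_sep => y; rewrite linearD linearZ linear_sum /=.
    have := h x y; rewrite big_cons linearD linear_sum /= tlift_tens => hxy.
    rewrite -[in RHS]hxy; congr (_ + _).
    by apply: eq_bigr => p _; rewrite tlift_tens linearZ.
  apply: (scalerI xu); rewrite scaler0 -[RHS]sv scalerDr; congr (_ + _).
  rewrite scaler_sumr; apply: eq_bigr => p _.
  by rewrite scalerA mulrCA mulfV // mulr1.
pose s' := [seq (p.1 - (phi x p.1 / phi x u) *: u, p.2) | p <- s].
have es : \sum_(p <- (u, v) :: s) tens p.1 p.2 = \sum_(p <- s') tens p.1 p.2.
  rewrite big_cons /= ve linearNr linear_sumr big_map -sumrN -big_split /=.
  apply: eq_bigr => p _; rewrite linearBl /= linearZl_LR linearZr_LR.
  by rewrite addrC.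
by rewrite es; apply: IH; [rewrite size_map | move=> y z; rewrite -es].
Qed.
End Separation.

End TensorMaps.

Section Comodules.
Variable k : fieldType.

Record coalgebra := Coalgebra {
  coalg_sort :> lmodType k;
  comul : {linear coalg_sort -> coalg_sort \ox coalg_sort};
  counit : {linear coalg_sort -> k^o};
  comulA : forall c,
    tassoc (tmap comul id (comul c)) = tmap id comul (comul c);
  counitl : forall c, tlift (fun a b => counit a *: b) (comul c) = c;
  counitr : forall c, tlift (fun a b => counit b *: a) (comul c) = c
}.

Arguments comul {C} : rename.
Arguments counit {C} : rename.

Variable C : coalgebra.

Record comodule := Comodule {
  comod_sort :> lmodType k;
  coact : {linear comod_sort -> comod_sort \ox C};
  coactA : forall m, tassoc (tmap coact id (coact m)) = tmap id (@comul C) (coact m);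
  coact1 : forall m, tlift (fun m' c => counit c *: m') (coact m) = m
}.

Arguments coact {M} : rename.

Definition comod_hom (M N : comodule) (f : {linear M -> N}) : Prop :=
  forall m, coact (f m) = tmap f id (coact m).

Definition subspace (V : lmodType k) (W : set V) : Prop :=
  W 0 /\ forall (a : k) u v, W u -> W v -> W (a *: u + v).

Definition subcomodule (M : comodule) (W : set M) : Prop :=
  subspace W /\
  forall m, W m -> exists s : seq (M * C),
    (forall p, p \in s -> W p.1) /\ coact m = \sum_(p <- s) tens p.1 p.2.

Definition simple_comodule (M : comodule) : Prop :=
  (exists m : M, m != 0) /\
  forall W : set M, subcomodule W -> W = [set 0] \/ W = setT.

Definition injective_comodule (I : comodule) : Prop :=
  forall (M N : comodule) (i : {linear M -> N}) (f : {linear M -> I}),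
    comod_hom i -> injective i -> comod_hom f ->
    exists g : {linear N -> I}, comod_hom g /\ forall m, g (i m) = f m.

Definition injective_envelope (M I : comodule) (i : {linear M -> I}) : Prop :=
  [/\ injective_comodule I, comod_hom i, injective i &
      forall W : set I, subcomodule W -> (exists w, W w /\ w != 0) ->
        exists m, W (i m) /\ i m != 0].

Definition finite_dimensional (V : lmodType k) : Prop :=
  exists n (e : 'I_n -> V), forall v, exists c : 'I_n -> k,
    v = \sum_(i < n) c i *: e i.

(* c |-> sum F(c_2)(c_1): the image of F under Hom(C, Hom(C, B)) = Hom(C (x) C, B),
   F |-> (d (x) c |-> F(c)(d)), followed by Hom(Delta, B).  This choice of the
   identification is what makes the contramodules below left contramodules. *)
Definition comul_uncurry (B : lmodType k) (F : {linear C -> hom C B}) :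
    hom C B :=
  tlift (uncurry_bil F) \o @comul C.

Definition counit_cst (B : lmodType k) (b : B) : C -> B :=
  fun c => counit c *: b.
Fact counit_cst_linear (B : lmodType k) (b : B) : linear (counit_cst b).
Proof. by move=> a c d; rewrite /counit_cst linearP scalerDl scalerA. Qed.
HB.instance Definition _ (B : lmodType k) (b : B) :=
  GRing.isLinear.Build k C B *:%R (counit_cst b) (counit_cst_linear b).

Record contramodule := Contramodule {
  contra_sort :> lmodType k;
  contract : {linear hom C contra_sort -> contra_sort};
  contractA : forall F : {linear C -> hom C contra_sort},
    contract (contract \o F : {linear _ -> _}) = contract (comul_uncurry F);
  contract1 : forall b : contra_sort, contract (counit_cst b : {linear _ -> _}) = b
}.

Arguments contract {B} : rename.

Definition contra_hom (B D : contramodule) (f : {linear B -> D}) : Prop :=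
  forall g : hom C B, f (contract g) = contract (f \o g : {linear _ -> _}).

Definition contra_iso (B D : contramodule) : Prop :=
  exists f : {linear B -> D}, contra_hom f /\ bijective f.

Definition subcontramodule (B : contramodule) (H : set B) : Prop :=
  subspace H /\ forall g : hom C B, (forall c, H (g c)) -> H (contract g).

Definition projective_contramodule (P : contramodule) : Prop :=
  forall (B D : contramodule) (e : {linear B -> D}) (f : {linear P -> D}),
    contra_hom e -> (forall d, exists b, e b = d) -> contra_hom f ->
    exists g : {linear P -> B}, contra_hom g /\ forall p, e (g p) = f p.

Definition superfluous_epi (P M : contramodule) (phi : {linear P -> M}) : Prop :=
  [/\ contra_hom phi, forall m, exists p, phi p = m &
      forall H : set P, subcontramodule H ->
        (forall p, exists h n, [/\ H h, phi n = 0 & p = h + n]) -> H = setT].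

Definition projective_cover (P M : contramodule) (phi : {linear P -> M}) : Prop :=
  projective_contramodule P /\ superfluous_epi phi.

Section Dual.
Variable M : comodule.

(* g |-> (m |-> sum g(m_1)(m_0)), where the coaction of m is sum m_0 (x) m_1. *)
Definition dual_contract_fun (g : hom C (hom M k^o)) : hom M k^o :=
  tlift (uncurry_bil g) \o @coact M.

Lemma dual_contract_funE (g : hom C (hom M k^o)) m :
  dual_contract_fun g m = \sum_(p <- repr (coact m)) g p.2 p.1.
Proof. by []. Qed.

Fact dual_contract_linear : linear dual_contract_fun.
Proof.
move=> a f g; apply: homP => m.
rewrite homDE homZE !dual_contract_funE scaler_sumr -big_split.
by apply: eq_bigr.
Qed.

HB.instance Definition _ := GRing.isLinear.Build k (hom C (hom M k^o))
  (hom M k^o) *:%R dual_contract_fun dual_contract_linear.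

Definition dual_contract : {linear hom C (hom M k^o) -> hom M k^o} :=
  dual_contract_fun.

Lemma dual_contractE (g : hom C (hom M k^o)) m :
  dual_contract g m = \sum_(p <- repr (coact m)) g p.2 p.1.
Proof. by []. Qed.

(* The trilinear map (m, d, c) |-> F(c)(d)(m). *)
Section Trilinear.
Variable F : {linear C -> hom C (hom M k^o)}.

Definition tri_bil1 (m : M) (d c : C) : k^o := F c d m.
Fact tri_bil1_bilinear m : bilinear_for *:%R *:%R (tri_bil1 m).
Proof. by split=> [v a u1 u2|u a v1 v2]; rewrite /tri_bil1 linearP. Qed.
HB.instance Definition _ m := bilinear_isBilinear.Build k C C k^o
  *:%R *:%R (tri_bil1 m) (tri_bil1_bilinear m).

Definition tri_bil (m : M) (t : C \ox C) : k^o := tlift (tri_bil1 m) t.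
Fact tri_bilinear : bilinear_for *:%R *:%R tri_bil.
Proof.
split=> [t a m1 m2|m a t1 t2]; last by rewrite /tri_bil linearP.
rewrite /tri_bil /tlift /bil_sum /= scaler_sumr -big_split.
by apply: eq_bigr => p _ /=; rewrite /tri_bil1 linearP.
Qed.
HB.instance Definition _ := bilinear_isBilinear.Build k M (C \ox C) k^o
  *:%R *:%R tri_bil tri_bilinear.
End Trilinear.

Fact dual_contractA (F : {linear C -> hom C (hom M k^o)}) :
  dual_contract (dual_contract \o F : {linear _ -> _}) =
  dual_contract (comul_uncurry F).
Proof.
apply: homP => m; rewrite !dual_contractE.
have -> : \sum_(p <- repr (coact m)) (dual_contract \o F) p.2 p.1 =
    tlift (tri_bil F) (tassoc (tmap (@coact M) id (coact m))).
  pose h : {linear _ -> _} := tlift (tri_bil F) \o (@tassoc k M C C) \o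
    tmap (@coact M) (@idfun C).
  rewrite -[RHS]/(h (coact m)) linear_tensorE; apply: eq_bigr => p _.
  rewrite [RHS]/= tmap_tens [LHS]dual_contractE.
  pose h' : {linear _ -> _} := tlift (tri_bil F) \o (@tassoc k M C C) \o
    applyr (@tens k (M \ox C) C) p.2.
  rewrite -[RHS]/(h' (coact p.1)) linear_tensorE; apply: eq_bigr => q _.
  rewrite [RHS]/= tassoc_tens [RHS](tlift_tens (tri_bil F)).
  by rewrite [RHS](tlift_tens (tri_bil1 F q.1)).
rewrite coactA.
pose h : {linear _ -> _} := tlift (tri_bil F) \o
  tmap (@idfun M) (@comul C).
rewrite -[LHS]/(h (coact m)) linear_tensorE; apply: eq_bigr => p _.
rewrite [LHS]/= tmap_tens tlift_tens /tri_bil.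
rewrite -[RHS]/((\sum_(q <- repr (comul p.2)) F q.2 q.1 : hom M k^o) p.1).
by rewrite hom_sumE.
Qed.

Fact dual_contract1 (f : hom M k^o) :
  dual_contract (counit_cst f : {linear _ -> _}) = f.
Proof.
apply: homP => m; rewrite dual_contractE.
rewrite -[in RHS](coact1 m) /tlift /bil_sum linear_sum.
by apply: eq_bigr => p _ /=; rewrite linearZ.
Qed.

Definition dual_contramodule : contramodule :=
  Contramodule dual_contractA dual_contract1.
End Dual.

End Comodules.

Arguments comul {k C} : rename.
Arguments counit {k C} : rename.
Arguments coact {k C M} : rename.
Arguments contract {k C B} : rename.

Section Systems.
Variables (k : fieldType) (C : coalgebra k).
Variables (d : Order.disp_t) (J : preorderType d).

Definition directed : Prop :=
  (exists j : J, True) /\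
  forall i j : J, exists l : J, (i <= l)%O /\ (j <= l)%O.

Record direct_system := DirectSystem {
  dir_obj :> J -> comodule C;
  dir_map : forall i j, (i <= j)%O -> {linear dir_obj i -> dir_obj j};
  dir_hom : forall i j (ij : (i <= j)%O), comod_hom (dir_map ij);
  dir_id : forall i (ii : (i <= i)%O), dir_map ii =1 id;
  dir_comp : forall i j l (ij : (i <= j)%O) (jl : (j <= l)%O) (il : (i <= l)%O),
    dir_map il =1 dir_map jl \o dir_map ij
}.

Definition direct_cocone (X : direct_system) (N : comodule C)
    (g : forall j, {linear X j -> N}) : Prop :=
  (forall j, comod_hom (g j)) /\
  forall i j (ij : (i <= j)%O), g j \o dir_map X ij =1 g i.

Definition direct_limit (X : direct_system) (I : comodule C)
    (inj : forall j, {linear X j -> I}) : Prop :=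
  direct_cocone inj /\
  forall (N : comodule C) (g : forall j, {linear X j -> N}),
    direct_cocone g ->
    exists h : {linear I -> N},
      [/\ comod_hom h, forall j, h \o inj j =1 g j &
          forall h' : {linear I -> N}, comod_hom h' ->
            (forall j, h' \o inj j =1 g j) -> h' =1 h].

Record inverse_system := InverseSystem {
  inv_obj :> J -> contramodule C;
  inv_map : forall i j, (i <= j)%O -> {linear inv_obj j -> inv_obj i};
  inv_hom : forall i j (ij : (i <= j)%O), contra_hom (inv_map ij);
  inv_id : forall i (ii : (i <= i)%O), inv_map ii =1 id;
  inv_comp : forall i j l (ij : (i <= j)%O) (jl : (j <= l)%O) (il : (i <= l)%O),
    inv_map il =1 inv_map ij \o inv_map jl
}.

Definition inverse_cone (Y : inverse_system) (N : contramodule C)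
    (g : forall j, {linear N -> Y j}) : Prop :=
  (forall j, contra_hom (g j)) /\
  forall i j (ij : (i <= j)%O), inv_map Y ij \o g j =1 g i.

Definition inverse_limit (Y : inverse_system) (Q : contramodule C)
    (proj : forall j, {linear Q -> Y j}) : Prop :=
  inverse_cone proj /\
  forall (N : contramodule C) (g : forall j, {linear N -> Y j}),
    inverse_cone g ->
    exists h : {linear N -> Q},
      [/\ contra_hom h, forall j, proj j \o h =1 g j &
          forall h' : {linear N -> Q}, contra_hom h' ->
            (forall j, proj j \o h' =1 g j) -> h' =1 h].

Section DualMap.
Variables (M N : comodule C) (f : {linear M -> N}).

Definition dual_map_fun (g : hom N k^o) : hom M k^o := g \o f.
Fact dual_map_linear : linear dual_map_fun.
Proof. by move=> a g h; apply: homP. Qed.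
HB.instance Definition _ := GRing.isLinear.Build k (hom N k^o) (hom M k^o)
  *:%R dual_map_fun dual_map_linear.

Definition dual_map :
    {linear dual_contramodule N -> dual_contramodule M} :=
  dual_map_fun.

Lemma dual_map_hom : comod_hom f -> contra_hom dual_map.
Proof.
move=> fP g; apply: homP => m.
rewrite -[LHS]/(tlift (uncurry_bil g) (coact (f m))) fP.
pose h : {linear _ -> _} := tlift (uncurry_bil g) \o tmap f (@idfun C).
rewrite -[LHS]/(h (coact m)) linear_tensorE [RHS]dual_contractE.
apply: eq_bigr => p _.
by rewrite [LHS]/= tmap_tens [LHS](tlift_tens (uncurry_bil g)).
Qed.
End DualMap.

Section DualSystem.
Variable X : direct_system.

Fact dual_system_hom i j (ij : (i <= j)%O) : contra_hom (dual_map (dir_map X ij)).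
Proof. exact/dual_map_hom/dir_hom. Qed.
Fact dual_system_id i (ii : (i <= i)%O) : dual_map (dir_map X ii) =1 id.
Proof. by move=> g; apply: homP => m /=; rewrite dir_id. Qed.
Fact dual_system_comp i j l (ij : (i <= j)%O) (jl : (j <= l)%O) (il : (i <= l)%O) :
  dual_map (dir_map X il) =1 dual_map (dir_map X ij) \o dual_map (dir_map X jl).
Proof. by move=> g; apply: homP => m /=; rewrite (dir_comp ij jl il). Qed.

Definition dual_system : inverse_system :=
  InverseSystem dual_system_hom dual_system_id dual_system_comp.
End DualSystem.

End Systems.

(* An affine algebraic group over an algebraically closed field, as a variety:
   a group together with a finitely generated algebra k[G] of functions on it,
   whose algebra maps k[G] -> k are exactly the evaluations at the points, and
   such that multiplication and inversion are morphisms.  The first of the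
   latter conditions provides Delta : k[G] -> k[G] (x) k[G], with
   Delta(f)(x, y) = f(x y). *)
Record alg_group (k : closedFieldType) := AlgGroup {
  points :> groupType;
  coord : comAlgType k;
  ev : points -> {lrmorphism coord -> k^o};
  coord_fg : exists n (e : 'I_n -> coord),
    forall f, exists P : {mpoly k[n]}, f = mmap (in_alg coord) e P;
  ev_sep : forall f, (forall x, ev x f = 0) -> f = 0;
  ev_points : forall phi : {lrmorphism coord -> k^o}, exists! x, ev x =1 phi;
  coord_comul : {linear coord -> coord \ox coord};
  coord_comulE : forall x y f,
    tlift (form_bil ev ev x y) (coord_comul f) = ev (x * y)%g f;
  coord_inv : coord -> coord;
  coord_invE : forall x f, ev x (coord_inv f) = ev x^-1%g f
}.

Section CoordinateCoalgebra.
Variables (k : closedFieldType) (G : alg_group k).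
Local Notation A := (coord G).
Local Notation Delta := (coord_comul G).

Definition coord_counit : {linear A -> k^o} := ev (1%g : G).

Definition ev2 (p : G * G) : {linear A \ox A -> k^o} :=
  tlift (form_bil (@ev k G) (@ev k G) p.1 p.2).

Lemma ev2E p f : ev2 p (Delta f) = ev (p.1 * p.2)%g f.
Proof. exact: coord_comulE. Qed.

Lemma ev2_sep t : (forall p, ev2 p t = 0) -> t = 0.
Proof.
by move=> h; apply: (tensor_sep (@ev_sep k G) (@ev_sep k G)) => x y; apply: (h (x, y)).
Qed.

Lemma ev_inj (f g : A) : (forall x : G, ev x f = ev x g) -> f = g.
Proof.
move=> h; apply/eqP; rewrite -subr_eq0; apply/eqP/(@ev_sep k G) => x.
by rewrite linearB /= h subrr.
Qed.

Fact coord_counitl f : tlift (fun a b => coord_counit a *: b) (Delta f) = f.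
Proof.
apply: ev_inj => x; rewrite -[in RHS](mul1g x) -coord_comulE.
by rewrite /tlift /bil_sum linear_sum; apply: eq_bigr => p _; rewrite linearZ.
Qed.

Fact coord_counitr f : tlift (fun a b => coord_counit b *: a) (Delta f) = f.
Proof.
apply: ev_inj => x; rewrite -[in RHS](mulg1 x) -coord_comulE.
rewrite /tlift /bil_sum linear_sum; apply: eq_bigr => p _.
by rewrite linearZ /=; apply: mulrC.
Qed.

Fact coord_comulA f :
  tassoc (tmap Delta id (Delta f)) = tmap id Delta (Delta f).
Proof.
apply/eqP; rewrite -subr_eq0; apply/eqP.
apply: (tensor_sep (@ev_sep k G) ev2_sep) => x [y z].
pose E : {linear _ -> _} := tlift (form_bil (@ev k G) ev2 x (y, z)).
rewrite -[LHS]/(E _) linearB; apply/eqP; rewrite subr_eq0; apply/eqP.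
transitivity (ev (x * y * z)%g f).
  pose h : {linear _ -> _} := E \o @tassoc k A A A \o tmap Delta (@idfun A).
  rewrite -[LHS]/(h (Delta f)) linear_tensorE -coord_comulE.
  apply: eq_bigr => p _; rewrite [LHS]/= tmap_tens.
  pose h' : {linear _ -> _} :=
    E \o @tassoc k A A A \o applyr (@tens k (A \ox A) A) p.2.
  rewrite -[LHS]/(h' (Delta p.1)) linear_tensorE.
  rewrite -[RHS]/(ev (x * y)%g p.1 * ev z p.2 : k) -coord_comulE mulr_suml.
  apply: eq_bigr => q _; rewrite [LHS]/= tassoc_tens.
  rewrite [LHS](tlift_tens (form_bil (@ev k G) ev2 x (y, z))).
  have ev2_tens : ev2 (y, z) (tens q.2 p.2) = ev y q.2 * ev z p.2.
    exact: (tlift_tens (form_bil (@ev k G) (@ev k G) y z)).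
  rewrite -[LHS]/(ev x q.1 * ev2 (y, z) (tens q.2 p.2) : k) ev2_tens.
  exact: mulrA.
rewrite -mulgA -coord_comulE.
pose h : {linear _ -> _} := E \o tmap (@idfun A) Delta.
rewrite -[RHS]/(h (Delta f)) [RHS]linear_tensorE.
apply: eq_bigr => p _; rewrite [RHS]/= tmap_tens.
rewrite [RHS](tlift_tens (form_bil (@ev k G) ev2 x (y, z))).
by rewrite -[RHS]/(ev x p.1 * ev2 (y, z) (Delta p.2) : k) ev2E.
Qed.

Definition coord_coalgebra : coalgebra k :=
  Coalgebra coord_comulA coord_counitl coord_counitr.
End CoordinateCoalgebra.

Definition gmodule (k : closedFieldType) (G : alg_group k) :=
  comodule (coord_coalgebra G).

(* g . m = sum m_0 m_1(g), where the coaction of m is sum m_0 (x) m_1. *)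
Definition gact (k : closedFieldType) (G : alg_group k) (M : gmodule G)
    (g : G) (m : M) : M :=
  tlift (fun (m' : M) (f : coord G) => ev g f *: m') (coact m).

Section Structure.
Variables (k : closedFieldType) (G : alg_group k).
Implicit Types (S H T B : set G).

Definition zclosed S : Prop :=
  exists F : set (coord G), forall x : G, S x <-> forall f, F f -> ev x f = 0.

Definition zconnected S : Prop :=
  forall Z1 Z2 : set G, zclosed Z1 -> zclosed Z2 ->
    S `<=` Z1 `|` Z2 -> S `&` Z1 `&` Z2 = set0 -> S `<=` Z1 \/ S `<=` Z2.

Definition subgroup H : Prop :=
  H 1%g /\ forall x y : G, H x -> H y -> H (x * y^-1)%g.

Definition normal_subgroup H : Prop :=
  subgroup H /\ forall g h : G, H h -> H (h ^ g)%g.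

Definition derived_subgroup H : set G :=
  [set x : G | forall K : set G, subgroup K ->
     (forall a b : G, H a -> H b -> K [~ a, b]%g) -> K x].

Definition solvable H : Prop :=
  exists n, iter n derived_subgroup H `<=` [set 1%g].

Definition semisimple : Prop :=
  zconnected setT /\
  forall R, zclosed R -> zconnected R -> normal_subgroup R -> solvable R ->
    R `<=` [set 1%g].

Definition closed_connected_solvable B : Prop :=
  [/\ zclosed B, zconnected B, subgroup B & solvable B].

Definition borel B : Prop :=
  closed_connected_solvable B /\ forall B', closed_connected_solvable B' -> B `<=` B' -> B' `<=` B.

(* T is the image of a closed embedding of some (k \ {0})^n; a regular function on
   (k \ {0})^n is a Laurent polynomial in the coordinates, and the coordinates
   must be restrictions of functions in k[G]. *)
Definition torus T : Prop :=
  exists n (phi : ('I_n -> k) -> G),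
    [/\ forall s t, (forall i, s i != 0) -> (forall i, t i != 0) ->
          phi (fun i => s i * t i) = (phi s * phi t)%g,
        forall f, exists (P : {mpoly k[n]}) m, forall t, (forall i, t i != 0) ->
          ev (phi t) f = P.@[t] / (\prod_i t i) ^+ m,
        forall i, exists f, forall t, (forall i, t i != 0) ->
          ev (phi t) f = t i &
        forall x, T x <-> exists2 t, (forall i, t i != 0) & phi t = x].

Definition maximal_torus T : Prop :=
  torus T /\ forall T', torus T' -> T `<=` T' -> T' `<=` T.

(* Characters of T are represented by functions on G, of which only the values
   on T matter; cocharacters by functions on k, of which only the values at
   nonzero arguments matter. *)

Definition character T (chi : G -> k) : Prop :=
  [/\ chi 1%g = 1, forall s t, T s -> T t -> chi (s * t)%g = chi s * chi t &
      exists f, forall t, T t -> chi t = ev t f].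

Definition cocharacter T (y : k -> G) : Prop :=
  [/\ forall z, z != 0 -> T (y z),
      forall z w, z != 0 -> w != 0 -> y (z * w) = (y z * y w)%g &
      forall f, exists (P : {poly k}) m, forall z, z != 0 ->
        ev (y z) f = P.[z] / z ^+ m].

Definition point_derivation (D : {linear coord G -> k^o}) : Prop :=
  forall f g, D (f * g) = ev (1%g : G) f * D g + D f * ev (1%g : G) g.

Definition tangent_to H (D : {linear coord G -> k^o}) : Prop :=
  forall f, (forall x, H x -> ev x f = 0) -> D f = 0.

(* D has weight alpha for the adjoint action of T: Ad(t) D is the derivation
   f |-> D (x |-> f (t x t^-1)). *)
Definition adjoint_weight T (alpha : G -> k) (D : {linear coord G -> k^o}) :
    Prop :=
  forall t, T t -> forall f h,
    (forall x : G, ev x h = ev (t * x * t^-1)%g f) -> D h = alpha t * D f.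

(* alpha is a nonzero weight of T on the Lie algebra of the closed subgroup H *)
Definition root_of T H (alpha : G -> k) : Prop :=
  [/\ character T alpha, exists2 t, T t & alpha t != 1 &
      exists D : {linear coord G -> k^o},
        [/\ exists f, D f != 0, point_derivation D, tangent_to H D &
            adjoint_weight T alpha D]].

Definition root T : (G -> k) -> Prop := root_of T setT.

Definition upper2 (a : k) : 'M[k]_2 := 1%:M + a *: delta_mx 0 1.
Definition lower2 (a : k) : 'M[k]_2 := 1%:M + a *: delta_mx 1 0.
Definition diag2 (z : k) : 'M[k]_2 := z *: delta_mx 0 0 + z^-1 *: delta_mx 1 1.

(* phi : SL_2 -> G is a homomorphism of algebraic groups which maps the upper
   and lower unitriangular matrices isomorphically, and T-equivariantly, to the
   root subgroups of alpha and - alpha. *)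
Definition root_SL2 T (alpha : G -> k) (phi : 'M[k]_2 -> G) : Prop :=
  [/\ forall M N, \det M = 1 -> \det N = 1 -> phi (M *m N) = (phi M * phi N)%g,
      forall f, exists P : {mpoly k[2 * 2]}, forall M, \det M = 1 ->
        ev (phi M) f = P.@[fun i => mxvec M 0 i],
      (exists f, forall a, ev (phi (upper2 a)) f = a) /\
      (exists f, forall a, ev (phi (lower2 a)) f = a),
      forall t a, T t ->
        (t * phi (upper2 a) * t^-1)%g = phi (upper2 (alpha t * a)) &
      forall t a, T t ->
        (t * phi (lower2 a) * t^-1)%g = phi (lower2 ((alpha t)^-1 * a))].

Definition coroot T (alpha : G -> k) (y : k -> G) : Prop :=
  exists2 phi, root_SL2 T alpha phi & forall z, z != 0 -> y z = phi (diag2 z).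

(* <chi, y> = n *)
Definition pairing (chi : G -> k) (y : k -> G) (n : int) : Prop :=
  forall z, z != 0 -> chi (y z) = z ^ n.

(* The coroots generate the cocharacter group of the maximal torus T.  As the
   negative of a coroot is a coroot, generation as a monoid is enough. *)
Definition simply_connected : Prop :=
  forall T, maximal_torus T -> forall y, cocharacter T y ->
    exists n (c : 'I_n -> k -> G),
      (forall i, exists2 alpha, root T alpha & coroot T alpha (c i)) /\
      forall z, z != 0 -> y z = (\prod_(i < n) c i z)%g.

(* The positive roots are the roots of B. *)
Definition dominant T B (lambda : G -> k) : Prop :=
  character T lambda /\
  forall alpha y n, root_of T B alpha -> coroot T alpha y ->
    pairing lambda y n -> 0 <= n.

(* M contains a nonzero vector of weight lambda that spans a B-stable line; if
   M is simple then lambda is the highest weight of M. *)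
Definition has_highest_weight T B (M : gmodule G) (lambda : G -> k) : Prop :=
  exists v : M,
    [/\ v != 0, forall t, T t -> gact t v = lambda t *: v &
        forall b, B b -> exists c : k, gact b v = c *: v].

End Structure.

(* Main.v *)
(* Limit: a linear form on a comodule is the same as a comodule map to the cofree
   comodule on k, so linear forms turn the colimit I = colim X_i of comodules
   into the limit I^* = lim X_i^*.
   Projectivity of I^*: a linear retraction q : I -> L of the inclusion of L
   induces a comodule map I -> L (x) C, which is injective because L is essential
   in I, and hence has a comodule retraction r; so I^* is a direct summand of the
   free contramodule (L (x) C)^* = Hom(C, L^* ).
   The map I^* -> L^* is superfluous: let H be a subcontramodule which together
   with the kernel spans I^*.  As L is finite-dimensional, the forms of a dual
   basis of L lift to elements h_i of H, which combine to a linear map t : I -> L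
   with t = id on L.  The comodule map gamma = r (t (x) id) Delta_I : I -> I is
   the identity on L, hence injective, hence split; and xi gamma is, for every xi
   in I^*, the contraction of a family of linear combinations of the h_i.
   So I^* = I^* gamma is contained in H. *)
Require Import Defs.
From HB Require Import structures.
From mathcomp Require Import all_boot all_order all_algebra.
From mathcomp Require Import boolp classical_sets.

Set Implicit Arguments.
Unset Strict Implicit.
Unset Printing Implicit Defensive.

Import GRing.Theory.

Local Open Scope ring_scope.
Local Open Scope classical_set_scope.

(** * Vector spaces of arbitrary dimension: complements, liftings, separating forms *)

Section LinearAlgebra.
Variable k : fieldType.

Definition linear_map (U V : lmodType k) (f : U -> V) (fP : linear f) :
    {linear U -> V} :=
  HB.pack f (GRing.isLinear.Build k U V *:%R f fP).

Lemma subspaceD (V : lmodType k) (W : set V) u v :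
  subspace W -> W u -> W v -> W (u + v).
Proof. by move=> [_ WP] Wu Wv; rewrite -[u]scale1r; apply: WP. Qed.

Lemma subspaceZ (V : lmodType k) (W : set V) a u :
  subspace W -> W u -> W (a *: u).
Proof. by move=> [W0 WP] Wu; rewrite -[_ *: _]addr0; apply: WP. Qed.

Lemma subspaceB (V : lmodType k) (W : set V) u v :
  subspace W -> W u -> W v -> W (u - v).
Proof.
by move=> WP Wu Wv; rewrite -scaleN1r; apply: subspaceD => //; apply: subspaceZ.
Qed.

Lemma subspace_sum (V : lmodType k) (W : set V) (T : Type) (s : seq T)
    (F : T -> V) :
  subspace W -> (forall i, W (F i)) -> W (\sum_(i <- s) F i).
Proof.
move=> WP WF; elim/big_rec: _ => [|i x _ Wx]; first by case: WP.
exact: subspaceD.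
Qed.

(** By Zorn, take [U] maximal among the subspaces that meet [W] trivially; a vector outside [U + W]
    could be adjoined to [U]. *)
Lemma subspace_complement (V : lmodType k) (W : set V) : subspace W ->
  exists2 U : set V, subspace U &
    (forall u, U u -> W u -> u = 0) /\
    (forall v, exists2 u, U u & W (v - u)).
Proof.
move=> WP.
(* [P] does not ask for 0, so that the union of the empty chain satisfies it; maximality puts 0 into
   [U] afterwards. *)
pose P (U : set V) := (forall a u v, U u -> U v -> U (a *: u + v)) /\
  forall u, U u -> W u -> u = 0.
have [|U [[UP U0] Umax]] := @Zorn_bigcup V P.
  move=> F FP Ftot; split=> [a u v [A FA Au] [B FB Bv]|u [A FA Au]]; last first.
    exact: (FP A FA).2.
  by case: (Ftot A B FA FB) => AB; [exists B | exists A] => //;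
    apply: (FP _ _).1 => //; apply: AB.
have Uz : U 0.
  have [[u Uu]|Ue] := pselect (exists u, U u).
    by rewrite -[0](addNr u) -scaleN1r; apply: UP.
  case: (Umax [set 0]); last first.
    by split=> [a u v -> ->|u -> //]; rewrite scaler0 addr0.
  split=> [u Uu|/(_ 0 erefl) h]; first by case: Ue; exists u.
  by apply: Ue; exists 0.
have US : subspace U by split.
exists U => //; split=> // v; apply: contrapT => vN.
pose U' := [set w | exists a u, U u /\ w = a *: v + u].
have UU' : U `<=` U' by move=> u Uu; exists 0, u; rewrite scale0r add0r.
case: (Umax U').
  split=> // h; apply: vN; exists v; last by rewrite subrr; case: WP.
  by apply: h; exists 1, 0; rewrite scale1r addr0.
split=> [a u w [b [u' [Uu' ->]]] [c [w' [Uw' ->]]]|w [a [u [Uu ->]]] Wau].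
  exists (a * b + c), (a *: u' + w'); split; first exact: UP.
  by rewrite scalerDr scalerA scalerDl addrACA.
have [a0|a0] := eqVneq a 0.
  by move: Wau; rewrite a0 scale0r add0r; apply: U0.
case: vN; exists (- (a^-1 *: u)).
  by rewrite -scaleNr; apply: subspaceZ.
rewrite opprK; have -> : v + a^-1 *: u = a^-1 *: (a *: v + u).
  by rewrite scalerDr scalerA mulVf // scale1r.
exact: subspaceZ.
Qed.

(** [pi] is the projection along [W] onto a complement. *)
Lemma subspace_projection (V : lmodType k) (W : set V) : subspace W ->
  exists pi : {linear V -> V},
    (forall v, W (v - pi v)) /\ (forall w, W w -> pi w = 0).
Proof.
move=> WP; have [U UP [UW0 UW]] := subspace_complement WP.
pose pi v := projT1 (cid2 (UW v)).
have piU v : U (pi v) by rewrite /pi; case: cid2.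
have piW v : W (v - pi v) by rewrite /pi; case: cid2.
have pi_uniq v u : U u -> W (v - u) -> pi v = u.
  move=> Uu Wvu; apply/eqP; rewrite -subr_eq0; apply/eqP/UW0.
    exact: subspaceB.
  by have := subspaceB WP Wvu (piW v); rewrite opprB addrC addrA addrNK.
have piL : linear pi.
  move=> a u v; apply: pi_uniq; first exact: UP.2.
  by rewrite opprD addrACA -scalerBr; apply: WP.2.
exists (linear_map piL); split=> // w Ww; apply: pi_uniq; first by case: UP.
by rewrite subr0.
Qed.

Lemma linear_lift (A B D : lmodType k) (e : {linear B -> D})
    (f : {linear A -> D}) :
  (forall a, exists b, e b = f a) -> exists l : {linear A -> B}, e \o l =1 f.
Proof.
move=> ef; have [|pi [pi1 pi0]] := @subspace_projection B [set b | e b = 0].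
  split=> /= [|a u v eu ev]; first exact: linear0.
  by rewrite linearP eu ev scaler0 addr0.
have epi b : e (pi b) = e b.
  by apply/esym/eqP; rewrite -subr_eq0 -linearB; apply/eqP/pi1.
have [s sE] := choice ef.
(* The preimages chosen by [s] are linear only modulo the kernel of [e], and [pi] kills that
   kernel. *)
have lL : linear (pi \o s).
  move=> c u v; rewrite /= -linearP; apply/eqP; rewrite -subr_eq0 -linearB.
  by apply/eqP/pi0; rewrite /= linearB linearP !sE linearP subrr.
by exists (linear_map lL) => a; rewrite /= epi sE.
Qed.

(** [v - pi v] lies in the range of [i] and equals [v] for [v] in the range, so lifting it through
    [i] gives the retraction. *)
Lemma linear_retraction (U V : lmodType k) (i : {linear U -> V}) :
  injective i -> exists q : {linear V -> U}, cancel i q.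
Proof.
move=> iI; have [|pi [pi1 pi0]] := @subspace_projection V (range i).
  split=> [|a _ _ [u _ <-] [v _ <-]]; first by exists 0; rewrite ?linear0.
  by exists (a *: u + v); rewrite ?linearP.
have cL : linear (fun v => v - pi v).
  by move=> a u v; rewrite linearP opprD addrACA scalerBr.
have [v|l lE] := @linear_lift _ _ _ i (linear_map cL).
  by have [u _ uE] := pi1 v; exists u.
by exists l => u; apply: iI; rewrite [LHS]lE /= pi0 ?subr0 //; exists u.
Qed.

(** For nonzero [v], a retraction of [a |-> a *: v] is a form with value 1 at [v]. *)
Lemma separating_form (V : lmodType k) (v : V) :
  (forall f : {linear V -> k^o}, f v = 0) -> v = 0.
Proof.
move=> fv; apply/eqP/negP => /negP v0.
have iL : linear (fun a : k^o => a *: v).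
  by move=> a b c; rewrite scalerDl scalerA.
have [a b /=|q qP] := @linear_retraction _ _ (linear_map iL).
  move/eqP; rewrite -subr_eq0 -scalerBl scaler_eq0 (negPf v0) orbF.
  by rewrite subr_eq0 => /eqP.
have := qP 1; rewrite /= scale1r fv => /esym/eqP.
by rewrite oner_eq0.
Qed.

(** The forms are the components of a linear section of the surjection from row vectors onto [V], so
    [e] may be any spanning family. *)
Lemma dual_basis (V : lmodType k) : finite_dimensional V ->
  exists n (e : 'I_n -> V) (f : 'I_n -> {linear V -> k^o}),
    forall v, v = \sum_i f i v *: e i.
Proof.
move=> [n [e eP]]; exists n, e.
have sL : linear (fun c : 'rV[k]_n => \sum_i c 0 i *: e i).
  move=> a u v; rewrite scaler_sumr -big_split; apply: eq_bigr => i _.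
  by rewrite !mxE scalerDl scalerA.
have [v|l lE] := @linear_lift _ _ _ (linear_map sL) (@idfun V).
  have [c ->] := eP v; exists (\row_i c i) => /=.
  by apply: eq_bigr => i _; rewrite mxE.
have fL i : linear (fun v => l v 0 i : k^o) by move=> a u v; rewrite linearP !mxE.
by exists (fun i => linear_map (fL i)) => v; rewrite -[LHS](lE v).
Qed.
End LinearAlgebra.

(** * Contraction of tensors with linear forms on the second factor *)

Section Slices.
Variable k : fieldType.

Definition bilinear_map (U V W : lmodType k) (b : U -> V -> W)
    (bP : bilinear_for *:%R *:%R b) : {bilinear U -> V -> W} :=
  HB.pack b (bilinear_isBilinear.Build k U V W *:%R *:%R b bP).

Lemma linear_tensor_eq (U V W : lmodType k) (f g : {linear U \ox V -> W}) :
  (forall u v, f (tens u v) = g (tens u v)) -> f =1 g.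
Proof. by move=> fg t; rewrite !linear_tensorE; apply: eq_bigr. Qed.

Lemma tmap_comp (U V U' V' U'' V'' : lmodType k)
    (f : {linear U -> U'}) (g : {linear V -> V'})
    (f' : {linear U' -> U''}) (g' : {linear V' -> V''}) t :
  tmap f' g' (tmap f g t) = tmap (f' \o f) (g' \o g) t.
Proof.
move: t; apply: (linear_tensor_eq (f := tmap f' g' \o tmap f g)
  (g := tmap (f' \o f) (g' \o g))) => u v.
by rewrite /= !tmap_tens.
Qed.

Lemma eq_tmap (U V U' V' : lmodType k) (f f' : U -> U') (g g' : V -> V') :
  f =1 f' -> g =1 g' -> tmap f g =1 tmap f' g'.
Proof. by move=> /funext -> /funext ->. Qed.

Lemma tmap_id (U V : lmodType k) (t : U \ox V) : tmap id id t = t.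
Proof.
move: t; apply: (linear_tensor_eq (f := tmap (@idfun U) (@idfun V))
  (g := @idfun (U \ox V))) => u v.
by rewrite /= tmap_tens.
Qed.

(** Applied to the coaction of a comodule, slices give the action of the dual algebra of [C]. *)
Definition slice (V C : lmodType k) (psi : C -> k^o) : V \ox C -> V :=
  tlift (fun v c => (psi c : k) *: v).

Section SliceLinear.
Variables (V C : lmodType k) (psi : {linear C -> k^o}).

Fact slice_bilinear : bilinear_for *:%R *:%R (fun (v : V) c => (psi c : k) *: v).
Proof.
split=> [c a u v|v a c c'].
  by rewrite scalerDr; congr (_ + _); rewrite scalerA [RHS]scalerA mulrC.
by rewrite linearP scalerDl [X in _ = X + _]scalerA.
Qed.

Fact slice_linear : linear (@slice V C psi).
Proof. exact: (tlift_linear (bilinear_map slice_bilinear)). Qed.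
HB.instance Definition _ :=
  GRing.isLinear.Build k (V \ox C) V *:%R (@slice V C psi) slice_linear.

Lemma slice_tens (v : V) (c : C) : slice psi (tens v c) = (psi c : k) *: v.
Proof. exact: (tlift_tens (bilinear_map slice_bilinear)). Qed.
End SliceLinear.

Lemma sliceE (V C : lmodType k) (psi : {linear C -> k^o}) (t : V \ox C) :
  slice psi t = \sum_(p <- repr t) (psi p.2 : k) *: p.1.
Proof. by []. Qed.

Lemma slice_tmap (V V' C C' : lmodType k) (f : {linear V -> V'})
    (g : {linear C -> C'}) (psi : {linear C' -> k^o}) t :
  slice psi (tmap f g t) = f (slice (psi \o g) t).
Proof.
move: t; apply: (linear_tensor_eq (f := slice psi \o tmap f g)
  (g := f \o slice (psi \o g))) => v c.
by rewrite /= tmap_tens !slice_tens linearZ.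
Qed.

(** Products of forms on the two factors separate tensors, and the product of [phi] and [psi]
    factors through [slice psi]. *)
Lemma slice_inj (V C : lmodType k) (t u : V \ox C) :
  (forall psi : {linear C -> k^o}, slice psi t = slice psi u) -> t = u.
Proof.
move=> tu; apply/eqP; rewrite -subr_eq0; apply/eqP.
apply: (@tensor_sep k V C _ _ (fun phi : {linear V -> k^o} => phi)
  (fun psi : {linear C -> k^o} => psi)) => [v|c|phi psi].
- exact: separating_form.
- exact: separating_form.
rewrite -[RHS](linear0 phi) -[X in phi X](subrr (slice psi u)).
rewrite -{1}(tu psi) -linearB; move: (t - u).
apply: (linear_tensor_eq
  (f := tlift (form_bil (fun phi => phi) (fun psi => psi) phi psi))
  (g := phi \o slice psi)) => v c.
rewrite [LHS]tlift_tens /= slice_tens linearZ; exact: mulrC.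
Qed.

(** For a projection [pi] along [W], all slices of (pi (x) id) t vanish. So t = ((id - pi) (x) id)
    t, whose first factors lie in [W]. *)
Lemma slice_mem (V C : lmodType k) (W : set V) (t : V \ox C) : subspace W ->
  (forall psi : {linear C -> k^o}, W (slice psi t)) ->
  exists s : seq (V * C),
    (forall p, p \in s -> W p.1) /\ t = \sum_(p <- s) tens p.1 p.2.
Proof.
move=> WP Wt; have [pi [pi1 pi0]] := subspace_projection WP.
exists [seq (p.1 - pi p.1, p.2) | p <- repr t]; split.
  by move=> _ /mapP [p _ ->]; apply: pi1.
have ept : tmap pi idfun t = 0.
  apply: slice_inj => psi; rewrite slice_tmap linear0; exact/pi0/Wt.
transitivity (t - tmap pi idfun t); first by rewrite ept subr0.
rewrite (linear_tensorE (tmap pi idfun)) {1}[t]tensorE big_map -sumrB.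
by apply: eq_bigr => p _; rewrite /= tmap_tens linearBl.
Qed.

Lemma linear_tensor3_eq (U V W Z : lmodType k)
    (f g : {linear (U \ox V) \ox W -> Z}) :
  (forall u v w, f (tens (tens u v) w) = g (tens (tens u v) w)) -> f =1 g.
Proof.
move=> fg; apply: linear_tensor_eq => t w; move: t.
apply: (linear_tensor_eq (f := f \o applyr (@tens k _ _) w)
  (g := g \o applyr (@tens k _ _) w)) => u v /=.
exact: fg.
Qed.

(** [chi \o slice psi] is the product form v (x) w |-> chi(v) psi(w). *)
Lemma slice_tassoc (U V W : lmodType k) (chi : {linear V -> k^o})
    (psi : {linear W -> k^o}) (t : (U \ox V) \ox W) :
  slice (chi \o slice psi) (tassoc t) = slice chi (slice psi t).
Proof.
move: t; apply: (linear_tensor3_eq (f := slice (chi \o slice psi) \o @tassoc k U V W)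
  (g := slice chi \o slice psi)) => u v w /=.
by rewrite tassoc_tens !slice_tens linearZ /= slice_tens linearZ slice_tens scalerA.
Qed.
End Slices.

(** * Subcomodules as subspaces stable under slices *)

Section Comodules.
Variables (k : fieldType) (C : coalgebra k).

(** The product of the dual algebra: c |-> sum chi(c_1) psi(c_2). *)
Definition convolution (chi psi : {linear C -> k^o}) : {linear C -> k^o} :=
  chi \o slice psi \o comul.

Lemma slice_coact (M : comodule C) (chi psi : {linear C -> k^o}) (m : M) :
  slice chi (coact (slice psi (coact m))) =
  slice (convolution chi psi) (coact m).
Proof.
rewrite -(slice_tmap coact idfun) -slice_tassoc coactA.
exact: (slice_tmap idfun comul (chi \o slice psi)).
Qed.

Lemma slice_counit (M : comodule C) (m : M) : slice counit (coact m) = m.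
Proof. exact: coact1. Qed.

Lemma subcomodule_slice (M : comodule C) (W : set M) : subspace W ->
  (forall (psi : {linear C -> k^o}) m, W m -> W (slice psi (coact m))) ->
  subcomodule W.
Proof.
by move=> WP Ws; split=> // m Wm; apply: slice_mem => // psi; apply: Ws.
Qed.

(** The slices of the coaction of a nonzero [m] form a subcomodule containing [m], hence all of [L].
    They lie in the span of the finitely many first factors in one expression of [coact m]. *)
Lemma simple_finite_dimensional (L : comodule C) :
  simple_comodule L -> finite_dimensional L.
Proof.
move=> [[m m0] Ls].
pose W := [set v | exists psi : {linear C -> k^o}, v = slice psi (coact m)].
have WP : subspace W.
  split; first by exists \0; rewrite sliceE big1 // => p _; rewrite scale0r.
  move=> a _ _ [psi ->] [chi ->]; exists ((a *: (psi : Defs.hom C k^o)) + chi).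
  rewrite !sliceE scaler_sumr -big_split; apply: eq_bigr => p _ /=.
  by rewrite scalerDl scalerA.
have [|W0|WT] := Ls W.
- apply: subcomodule_slice => // psi _ [chi ->].
  by exists (convolution psi chi); rewrite slice_coact.
- have : W m by exists counit; rewrite slice_counit.
  by rewrite W0 => /= /eqP; rewrite (negPf m0).
set s := repr (coact m) in WT *.
exists (size s), (fun i => (tnth (in_tuple s) i).1) => v.
have [psi ->] : W v by rewrite WT.
exists (fun i => psi (tnth (in_tuple s) i).2).
by rewrite sliceE big_tnth.
Qed.

Lemma kernel_subcomodule (M N : comodule C) (f : {linear M -> N}) :
  comod_hom f -> subcomodule [set m | f m = 0].
Proof.
move=> fP; apply: subcomodule_slice => [|psi m /= fm0].
  split=> [|a u v /= fu fv]; first exact: linear0.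
  by rewrite linearP fu fv scaler0 addr0.
by rewrite -(slice_tmap f idfun) -fP fm0 !linear0.
Qed.

(** By essentiality, a nonzero kernel of [f] would contain a nonzero vector of the image of [L]. *)
Lemma envelope_injective (L I N : comodule C) (i : {linear L -> I})
    (f : {linear I -> N}) :
  injective_envelope i -> comod_hom f -> injective (f \o i) -> injective f.
Proof.
move=> [_ _ _ iess] fP fi x y fxy; apply/eqP; rewrite -subr_eq0.
apply/negPn/negP => xy0.
have [|m [/= fim]] := iess _ (kernel_subcomodule fP).
  by exists (x - y); rewrite /= linearB fxy subrr.
have -> : m = 0 by apply: fi; rewrite /= fim !linear0.
by rewrite linear0 eqxx.
Qed.
End Comodules.

(** * Reassociation of triple tensors *)

Section TassocInjective.
Variables (k : fieldType).

Fact tens_linear (U V : lmodType k) (u : U) : linear (@tens k U V u).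
Proof. by move=> a v w; rewrite linearPr. Qed.
HB.instance Definition _ (U V : lmodType k) (u : U) :=
  GRing.isLinear.Build k V (U \ox V) *:%R (@tens k U V u) (tens_linear u).

(** Iterated slices separate triple tensors and can be read off after reassociation. *)
Lemma tassoc_inj (U V W : lmodType k) : injective (@tassoc k U V W).
Proof.
move=> t u tu; apply: slice_inj => psi; apply: slice_inj => chi.
by rewrite -!slice_tassoc tu.
Qed.

Lemma tassoc_tmap (U U' V W : lmodType k) (f : {linear U -> U'})
    (t : (U \ox V) \ox W) :
  tassoc (tmap (tmap f idfun) idfun t) = tmap f idfun (tassoc t).
Proof.
move: t; apply: (linear_tensor3_eq
  (f := @tassoc k U' V W \o tmap (tmap f (@idfun V)) (@idfun W))
  (g := tmap f (@idfun (V \ox W)) \o @tassoc k U V W)) => u v w /=.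
by rewrite tmap_tens /= tmap_tens !tassoc_tens tmap_tens.
Qed.

Lemma tassoc_tmap_tens (U V W : lmodType k) (u : U) (t : V \ox W) :
  tassoc (tmap (tens u) idfun t) = tens u t.
Proof.
move: t; apply: (linear_tensor_eq
  (f := @tassoc k U V W \o tmap (@tens k U V u) (@idfun W))
  (g := @tens k U (V \ox W) u)) => v w /=.
by rewrite tmap_tens tassoc_tens.
Qed.
End TassocInjective.

(** * Cofree comodules and their universal maps *)

Section Cofree.
Variables (k : fieldType) (C : coalgebra k) (V : lmodType k).

(** This is sum (v (x) c_1) (x) c_2, that is, v (x) Delta(c) bracketed to the left without inverting
    [tassoc]. *)
Definition cofree_bil (v : V) (c : C) : (V \ox C) \ox C :=
  tmap (tens v) idfun (comul c).

Fact cofree_bilinear : bilinear_for *:%R *:%R cofree_bil.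
Proof.
split=> [c a u v|v a c c']; apply: tassoc_inj;
  rewrite [RHS](@linearP _ _ _ _ (@tassoc k V C C)) /cofree_bil.
  by rewrite /= !tassoc_tmap_tens linearPl.
by rewrite /= !tassoc_tmap_tens linearP linearPr.
Qed.

Definition cofree_coact : {linear V \ox C -> (V \ox C) \ox C} :=
  tlift (bilinear_map cofree_bilinear).

Lemma cofree_coact_tens v c :
  cofree_coact (tens v c) = tmap (tens v) idfun (comul c).
Proof. exact: (tlift_tens (bilinear_map cofree_bilinear)). Qed.

Lemma tassoc_cofree_coact t : tassoc (cofree_coact t) = tmap idfun comul t.
Proof.
move: t; apply: (linear_tensor_eq (f := @tassoc k V C C \o cofree_coact)
  (g := tmap (@idfun V) (@comul k C))) => v c /=.
by rewrite tmap_tens cofree_coact_tens tassoc_tmap_tens.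
Qed.

Fact cofree_coactA t :
  tassoc (tmap cofree_coact idfun (cofree_coact t)) = tmap idfun comul (cofree_coact t).
Proof.
move: t; apply: (linear_tensor_eq
  (f := @tassoc k (V \ox C) C C \o tmap cofree_coact (@idfun C) \o cofree_coact)
  (g := tmap (@idfun (V \ox C)) (@comul k C) \o cofree_coact)) => v c.
rewrite -[LHS]/(tassoc (tmap cofree_coact idfun (cofree_coact (tens v c)))).
rewrite -[RHS]/(tmap idfun comul (cofree_coact (tens v c))).
rewrite !cofree_coact_tens !tmap_comp.
transitivity (tassoc (tmap (tmap (tens v) idfun) idfun (tmap comul idfun (comul c)))).
  rewrite tmap_comp; congr tassoc; apply: eq_tmap => // b.
  exact: cofree_coact_tens.
rewrite tassoc_tmap comulA [LHS](tmap_comp idfun comul (tens v) idfun).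
by apply: eq_tmap.
Qed.

Fact cofree_coact1 t :
  @slice k (V \ox C) C counit (cofree_coact t) = t.
Proof.
move: t; apply: (linear_tensor_eq (f := slice counit \o cofree_coact)
  (g := @idfun _)) => v c /=.
rewrite cofree_coact_tens slice_tmap; congr (tens v _); exact: counitr.
Qed.

Definition cofree : comodule C := Comodule cofree_coactA cofree_coact1.

(** The comodule map that corresponds to [f] in the universal property of the cofree comodule; the
    counit recovers [f] from it. *)
Definition cofree_map (M : comodule C) (f : {linear M -> V}) :
    {linear M -> cofree} :=
  tmap f idfun \o coact.

(** After reassociation both sides are f (x) Delta applied to the coaction of [m]. *)
Lemma cofree_map_hom (M : comodule C) (f : {linear M -> V}) :
  comod_hom (cofree_map f).
Proof.
move=> m; apply: tassoc_inj.
rewrite [LHS]tassoc_cofree_coact.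
transitivity (tmap f comul (coact m)).
  by rewrite /cofree_map /= tmap_comp; apply: eq_tmap.
rewrite -[X in tassoc X](tmap_comp coact idfun (tmap f idfun) idfun).
rewrite tassoc_tmap coactA [RHS](tmap_comp idfun comul f idfun).
by apply: eq_tmap.
Qed.

Lemma cofree_mapK (M : comodule C) (f : {linear M -> V}) m :
  slice counit (cofree_map f m) = f m.
Proof. by rewrite slice_tmap [slice _ _]coact1. Qed.

Lemma cofree_map_comp (M N : comodule C) (g : {linear M -> N})
    (f : {linear N -> V}) m :
  comod_hom g -> cofree_map f (g m) = cofree_map (f \o g) m.
Proof.
by move=> gP; rewrite /cofree_map /= gP [LHS](tmap_comp g idfun f idfun); apply: eq_tmap.
Qed.
End Cofree.

(** * Projectivity of the dual of a retract of a cofree comodule *)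

Section RetractOfCofree.
Variables (k : fieldType) (C : coalgebra k) (V : lmodType k) (I : comodule C).
Variables (q : {linear I -> V}) (r : {linear cofree C V -> I}).
Hypothesis r_hom : comod_hom r.
Hypothesis qK : forall x, r (cofree_map q x) = x.

Fact coefficient_linear (xi : Defs.hom I k^o) (c : C) :
  linear (fun v : V => xi (r (tens v c))).
Proof. by move=> a u v; rewrite linearPl !linearP. Qed.

Definition coefficient xi c : Defs.hom V k^o :=
  linear_map (coefficient_linear xi c).

Fact coefficientl_linear xi : linear (coefficient xi).
Proof. by move=> a c c'; apply: homP => v /=; rewrite linearPr !linearP. Qed.

(** The dual of [r], with values in the free contramodule on the dual of [V]. *)
Definition coefficients xi : Defs.hom C (Defs.hom V k^o) :=
  linear_map (coefficientl_linear xi).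

Lemma coefficientsP a (xi eta : Defs.hom I k^o) (c : C) :
  coefficients (a *: xi + eta) c = a *: coefficients xi c + coefficients eta c.
Proof. exact: homP. Qed.

(** The right-hand side is the contraction in the free contramodule: since [r] is a comodule map,
    [coefficients] is a contramodule map. *)
Lemma coefficients_contract (F : Defs.hom C (dual_contramodule I)) (c : C) :
  coefficients (contract F) c =
  \sum_(p <- repr (comul c)) coefficients (F p.2) p.1.
Proof.
apply: homP => v; rewrite hom_sumE.
rewrite -[LHS]/(tlift (uncurry_bil F) (coact (r (tens v c)))) r_hom.
rewrite [coact _](cofree_coact_tens v c).
rewrite [tmap _ _ _](tmap_comp (tens v) idfun r idfun).
pose h : {linear _ -> _} :=
  tlift (uncurry_bil F) \o tmap (r \o @tens k V C v) (idfun \o @idfun C).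
rewrite -[LHS]/(h (comul c)) linear_tensorE; apply: eq_bigr => p _.
by rewrite [LHS]/= tmap_tens [LHS](tlift_tens (uncurry_bil F)).
Qed.

Fact precomp_linear : linear (fun alpha : Defs.hom V k^o => alpha \o q : Defs.hom I k^o).
Proof. by move=> a u v; apply: homP. Qed.

Definition precomp : {linear Defs.hom V k^o -> dual_contramodule I} :=
  linear_map precomp_linear.

(** The dual of [qK]: the forms that factor through [q] generate the dual of [I] as a
    contramodule. *)
Lemma contract_coefficients (xi : dual_contramodule I) :
  contract (precomp \o coefficients xi : {linear _ -> _}) = xi.
Proof.
apply: homP => x; rewrite [LHS]dual_contractE -[x in RHS]qK.
pose h : {linear _ -> _} := xi \o r \o tmap q (@idfun C).
rewrite -[RHS]/(h (coact x)) linear_tensorE; apply: eq_bigr => p _.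
by rewrite [RHS]/= tmap_tens.
Qed.

Section Extension.
Variables (B : contramodule C) (l : {linear Defs.hom V k^o -> B}).

(** The contramodule map given by [l] on the generators of the free contramodule sends [g] to
    [contract (l \o g)]; here it is composed with [coefficients]. *)
Definition extension_fun (xi : dual_contramodule I) : B :=
  contract (l \o coefficients xi : {linear _ -> _}).

Fact extension_linear : linear extension_fun.
Proof.
move=> a xi eta; rewrite -linearP; congr (contract _); apply: homP => c.
by rewrite -[LHS]/(l (coefficients (a *: xi + eta) c)) coefficientsP linearP.
Qed.

Definition extension : {linear dual_contramodule I -> B} :=
  linear_map extension_linear.

Lemma extension_hom : contra_hom extension.
Proof.
move=> F.
have GL : linear (fun c => l \o coefficients (F c) : Defs.hom C B).
  move=> a c c'; apply: homP => d.
  rewrite -[LHS]/(l (coefficients (F (a *: c + c')) d)) [F _]linearP.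
  by rewrite coefficientsP linearP.
(* Both sides contract the double family [(c, d) |-> l (coefficients (F c) d)], either in two steps
   or once along the comultiplication. *)
transitivity (contract (contract \o linear_map GL : {linear _ -> _})); last first.
  by congr (contract _); apply: homP.
rewrite contractA.
congr (contract _); apply: homP => c.
rewrite -[LHS]/(l (coefficients (contract F) c)) coefficients_contract linear_sum.
by apply: eq_bigr.
Qed.

(** Expand [xi] in the generators [precomp alpha] and move [e] and [f] inside the contraction. *)
Lemma extension_lift (D : contramodule C) (e : {linear B -> D})
    (f : {linear dual_contramodule I -> D}) :
  contra_hom e -> contra_hom f -> (forall alpha, e (l alpha) = f (precomp alpha)) ->
  forall xi, e (extension xi) = f xi.
Proof.
move=> eP fP ef xi; rewrite -{2}(contract_coefficients xi) fP [LHS]eP.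
by congr (contract _); apply: homP => c; apply: ef.
Qed.
End Extension.

Lemma retract_dual_projective : projective_contramodule (dual_contramodule I).
Proof.
move=> B D e f eP e_surj fP.
have [|l el] := @linear_lift _ _ _ _ e (f \o precomp).
  by move=> alpha; apply: e_surj.
by exists (extension l); split; [apply: extension_hom | apply: extension_lift].
Qed.
End RetractOfCofree.

(** * The dual of the injective envelope as a projective cover *)

Section InjectiveEnvelope.
Variables (k : fieldType) (C : coalgebra k) (L I : comodule C).
Variable iota : {linear L -> I}.
Hypothesis I_env : injective_envelope iota.

Lemma envelope_retract :
  exists (q : {linear I -> L}) (r : {linear cofree C L -> I}),
    [/\ cancel iota q, comod_hom r & forall x, r (cofree_map q x) = x].
Proof.
have [I_inj iotaP iota_inj _] := I_env.
have [q qK] := linear_retraction iota_inj.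
have j_inj : injective (cofree_map q).
  apply: (envelope_injective I_env); first exact: cofree_map_hom.
  (* On [L] the map is the coaction of [L], because [q] retracts [iota]; the counit is a left
     inverse of it. *)
  apply: (can_inj (g := slice counit)) => l.
  by rewrite [X in slice _ X](cofree_map_comp q l iotaP) cofree_mapK /= qK.
have [|r [rP rK]] := I_inj _ _ _ (@idfun I) (cofree_map_hom q) j_inj.
  by move=> m; rewrite [RHS]tmap_id.
by exists q, r.
Qed.

Lemma dual_envelope_projective : projective_contramodule (dual_contramodule I).
Proof.
have [q [r [_ r_hom qK]]] := envelope_retract.
exact: retract_dual_projective r_hom qK.
Qed.

Lemma dual_envelope_superfluous :
  finite_dimensional L -> superfluous_epi (dual_map iota).
Proof.
move=> L_fin; have [I_inj iotaP iota_inj _] := I_env.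
have [q [r [iotaK r_hom qK]]] := envelope_retract.
have q_iota (alpha : Defs.hom L k^o) : dual_map iota (precomp q alpha) = alpha.
  by apply: homP => l /=; rewrite iotaK.
split; first exact: dual_map_hom.
  by move=> alpha; exists (precomp q alpha).
move=> H [HP Hc] Hn.
have [n [e [f ef]]] := dual_basis L_fin.
(* Extend [f i] to [I] by [q] and keep the component in [H]; the other component vanishes on [L]. *)
have /choice [h hP] (i : 'I_n) :
    exists h : dual_contramodule I, H h /\ forall l, h (iota l) = f i l.
  have [h [m [Hh m0 hm]]] := Hn (precomp q (f i)).
  exists h; split=> // l; rewrite -[in RHS](q_iota (f i)) hm linearD m0 addr0.
  by [].
have tL : linear (fun x => \sum_i (h i x : k) *: e i).
  move=> a x y; rewrite scaler_sumr -big_split; apply: eq_bigr => i _.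
  by rewrite linearP scalerDl scalerA.
pose t := linear_map tL.
(* With [q] in place of [t] this would be the identity, and [t] agrees with [q] on [L]. *)
pose gamma : {linear I -> I} := r \o cofree_map t.
have gamma_hom : comod_hom gamma.
  move=> x; rewrite [LHS]r_hom cofree_map_hom [LHS](tmap_comp _ idfun r idfun).
  by apply: eq_tmap.
have gamma_iota l : gamma (iota l) = iota l.
  rewrite -[RHS]qK [cofree_map q _](cofree_map_comp q l iotaP).
  rewrite -[LHS]/(r (cofree_map t (iota l))) (cofree_map_comp t l iotaP).
  congr (r _); apply: eq_tmap => // l' /=; rewrite iotaK [RHS]ef.
  by apply: eq_bigr => i _; rewrite (hP i).2.
have gamma_inj : injective gamma.
  apply: (envelope_injective I_env gamma_hom).
  by apply: (eq_inj iota_inj) => l; rewrite -[LHS]gamma_iota.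
(* [s] is a left inverse of [gamma], so every form [eta] is [eta \o s \o gamma]. *)
have [|s [_ sK]] := I_inj _ _ _ (@idfun I) gamma_hom gamma_inj.
  by move=> m; rewrite [RHS]tmap_id.
rewrite -subTset => eta _.
pose xi : Defs.hom I k^o := eta \o s.
(* Expanding [t] in sum xi(r(t(x_0) (x) x_1)) exhibits [eta] as the contraction of this family,
   whose values are combinations of the [h i]. *)
have gL : linear (fun c : C => \sum_i (coefficients r xi c (e i) : k) *: h i).
  move=> a c c'; rewrite scaler_sumr -big_split; apply: eq_bigr => i _.
  by rewrite linearP scalerDl scalerA.
have -> : eta = contract (linear_map gL).
  apply: homP => x; rewrite -{1}[x]sK [RHS]dual_contractE.
  pose F : {linear _ -> _} := xi \o r \o tmap t (@idfun C).
  rewrite -[LHS]/(F (coact x)) linear_tensorE; apply: eq_bigr => p _.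
  rewrite -[LHS]/(xi (r (tmap t idfun (tens p.1 p.2)))) tmap_tens.
  rewrite [RHS]hom_sumE -[LHS]/(coefficients r xi p.2 (t p.1)).
  rewrite linear_sum; apply: eq_bigr => i _.
  by rewrite linearZ homZE; apply: mulrC.
apply: Hc => c; apply: subspace_sum => // i; apply: subspaceZ => //.
exact: (hP i).1.
Qed.
End InjectiveEnvelope.

(** * The dual of a direct limit as an inverse limit *)

Section DualOfLimit.
Variables (k : fieldType) (C : coalgebra k).
Variables (d : Order.disp_t) (J : preorderType d) (X : direct_system C J).
Variables (I : comodule C) (inj : forall j : J, {linear X j -> I}).
Hypothesis I_lim : direct_limit inj.

Lemma limit_form_exists (l : forall j, {linear X j -> k^o}) :
  (forall i j (ij : (i <= j)%O), l j \o dir_map X ij =1 l i) ->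
  exists xi : Defs.hom I k^o, forall j x, xi (inj j x) = l j x.
Proof.
move=> l_compat.
(* Forms on [X j] are comodule maps to the cofree comodule on the ground field, so the universal
   property glues compatible forms. *)
have [|h [_ hl _]] := I_lim.2 (cofree C k^o) (fun j => cofree_map (l j)).
  split=> [j|i j ij x]; first exact: cofree_map_hom.
  rewrite [LHS](cofree_map_comp (l j) x (@dir_hom _ _ _ _ X i j ij)).
  by apply: eq_tmap => // y; apply: l_compat.
exists (slice counit \o h) => j x.
by rewrite -(cofree_mapK (l j)) -[cofree_map _ _]hl.
Qed.

Lemma limit_form_unique (xi eta : Defs.hom I k^o) :
  (forall j x, xi (inj j x) = eta (inj j x)) -> xi = eta.
Proof.
move=> xi_eta; have [[injP inj_compat] I_univ] := I_lim.
(* Both [cofree_map xi] and [cofree_map eta] solve the universal problem for this cocone. *)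
have [|h [_ _ h_uniq]] := I_univ (cofree C k^o) (fun j => cofree_map xi \o inj j).
  split=> [j x|i j ij x].
    rewrite [LHS](cofree_map_hom xi) injP [LHS](tmap_comp _ idfun _ idfun).
    exact: eq_tmap.
  by rewrite /= -[in RHS](inj_compat _ _ ij).
apply: homP => x; rewrite -(cofree_mapK xi) -(cofree_mapK eta); congr (slice _ _).
rewrite h_uniq //; last exact: cofree_map_hom.
symmetry; apply: h_uniq => [|j y]; first exact: cofree_map_hom.
rewrite [LHS](cofree_map_comp eta y (injP j)) [RHS](cofree_map_comp xi y (injP j)).
by apply: eq_tmap => // z; rewrite /= xi_eta.
Qed.

Lemma dual_inverse_limit :
  @inverse_limit _ _ _ _ (dual_system X) (dual_contramodule I)
    (fun j => dual_map (inj j)).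
Proof.
have [injP inj_compat] := I_lim.1; split.
  split=> [j|i j ij xi]; first exact: dual_map_hom.
  by apply: homP => x /=; rewrite -[in RHS](inj_compat _ _ ij).
move=> N g [gP g_compat].
(* The mediating map glues the forms [g j n]; its properties are checked on the [X j], whose images
   determine forms on [I]. *)
have /choice [h hP] (n : N) :
    exists xi : dual_contramodule I, forall j, dual_map (inj j) xi = g j n.
  have [|xi xiE] := @limit_form_exists (fun j => g j n).
    by move=> i j ij x; rewrite -(g_compat _ _ ij).
  by exists xi => j; apply: homP => x; rewrite [LHS]xiE.
have dual_uniq (xi eta : dual_contramodule I) :
    (forall j, dual_map (inj j) xi = dual_map (inj j) eta) -> xi = eta.
  move=> xi_eta; apply: limit_form_unique => j x.
  exact: (congr1 (fun f : Defs.hom (X j) k^o => f x) (xi_eta j)).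
have hL : linear h.
  by move=> a m n; apply: dual_uniq => j; rewrite linearP !hP linearP.
exists (linear_map hL); split=> [F|j n|h' h'P h'g n]; last 1 first.
- by apply: dual_uniq => j; rewrite [RHS]hP; apply: h'g.
- apply: dual_uniq => j; rewrite [LHS]hP gP [RHS](dual_map_hom (injP j)).
  by congr (contract _); apply: homP => c; rewrite [RHS]hP.
- exact: hP.
Qed.
End DualOfLimit.

(** * Uniqueness of projective covers and of inverse limits *)

Section Uniqueness.
Variables (k : fieldType) (C : coalgebra k).

Lemma contra_hom_id (B : contramodule C) : contra_hom (@idfun B).
Proof. by move=> g; congr (contract _); apply: homP. Qed.

Lemma contra_hom_comp (A B D : contramodule C) (g : {linear B -> D})
    (f : {linear A -> B}) :
  contra_hom g -> contra_hom f -> contra_hom (g \o f).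
Proof.
by move=> gP fP F; rewrite /= fP gP; congr (contract _); apply: homP.
Qed.

(** A family with values in the range lifts linearly to [A], and the contraction of the lift is a
    preimage. *)
Lemma range_subcontramodule (A B : contramodule C) (f : {linear A -> B}) :
  contra_hom f -> subcontramodule (range f).
Proof.
move=> fP; split.
  split; first by exists 0; rewrite ?linear0.
  by move=> a _ _ [x _ <-] [y _ <-]; exists (a *: x + y); rewrite ?linearP.
move=> g gf; have [|l lE] := @linear_lift _ _ _ _ f g.
  by move=> c; have [a _ aE] := gf c; exists a.
by exists (contract l) => //; rewrite fP; congr (contract _); apply: homP.
Qed.

(** Since [psi] is onto, the range of [f] and the kernel of [phi] together span [P]. *)
Lemma superfluous_surjective (A P M : contramodule C) (phi : {linear P -> M})
    (psi : {linear A -> M}) (f : {linear A -> P}) :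
  superfluous_epi phi -> contra_hom f -> (forall m, exists a, psi a = m) ->
  (forall a, phi (f a) = psi a) -> forall p, exists a, f a = p.
Proof.
move=> [_ _ phi_sup] fP psi_surj phif p.
have rT : range f = setT.
  apply: phi_sup; first exact: range_subcontramodule.
  move=> x; have [a aE] := psi_surj (phi x); exists (f a), (x - f a).
  split; [by exists a | by rewrite linearB phif aE subrr | by rewrite addrC subrK].
by have : range f p by [rewrite rT]; move=> [a _ <-]; exists a.
Qed.

(** A lift [g] of [phi] through [phi'] is onto, hence splits by projectivity of [P']. The section
    [s] is onto for the same reason, so [g] and [s] are mutually inverse. *)
Lemma projective_cover_unique (P P' M : contramodule C)
    (phi : {linear P -> M}) (phi' : {linear P' -> M}) :
  projective_cover phi -> projective_cover phi' -> contra_iso P P'.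
Proof.
move=> [P_proj P_sup] [P'_proj P'_sup].
have [[phiP phi_surj _] [phi'P phi'_surj _]] := (P_sup, P'_sup).
have [g [gP phi'g]] := P_proj _ _ _ _ phi'P phi'_surj phiP.
have g_surj := superfluous_surjective P'_sup gP phi_surj phi'g.
have [s [sP gs]] := P'_proj _ _ _ (@idfun P') gP g_surj (@contra_hom_id P').
have phis x : phi (s x) = phi' x by rewrite -phi'g gs.
have s_surj := superfluous_surjective P_sup sP phi'_surj phis.
exists g; split=> //; exists s => // x.
by have [y <-] := s_surj x; rewrite gs.
Qed.

Lemma inverse_limit_unique (d : Order.disp_t) (J : preorderType d)
    (Y : inverse_system C J) (P Q : contramodule C)
    (f : forall j, {linear P -> Y j}) (g : forall j, {linear Q -> Y j}) :
  inverse_limit f -> inverse_limit g -> contra_iso P Q.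
Proof.
move=> [f_cone f_univ] [g_cone g_univ].
have [u [uP gu _]] := g_univ _ _ f_cone; have [v [vP fv _]] := f_univ _ _ g_cone.
(* [e] and [e'] mediate from each limit to itself; the composites and the identities both equal
   them. *)
have [e [_ _ e_uniq]] := f_univ _ _ f_cone.
have [e' [_ _ e'_uniq]] := g_univ _ _ g_cone.
exists u; split=> //; exists v => x.
  rewrite -[LHS]/((v \o u) x) e_uniq; last 2 first.
  - exact: contra_hom_comp.
  - by move=> j y; rewrite -gu; apply: fv.
  by rewrite -(e_uniq (@idfun P)) //; apply: contra_hom_id.
rewrite -[LHS]/((u \o v) x) e'_uniq; last 2 first.
- exact: contra_hom_comp.
- by move=> j y; rewrite -fv; apply: gu.
by rewrite -(e'_uniq (@idfun Q)) //; apply: contra_hom_id.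
Qed.

Lemma contra_iso_trans (A B D : contramodule C) :
  contra_iso A B -> contra_iso B D -> contra_iso A D.
Proof.
move=> [f [fP f_bij]] [g [gP g_bij]]; exists (g \o f).
by split; [apply: contra_hom_comp | apply: bij_comp].
Qed.
End Uniqueness.

(** * Identification of the projective cover with the inverse limit *)

Theorem theorem0p3
  (p : nat) (k : closedFieldType) (k_char_p : p \in [pchar k])
  (G : alg_group k) (G_semisimple : semisimple G)
  (G_simply_connected : simply_connected G)
  (T B : set G) (T_maximal : maximal_torus T) (B_borel : borel B)
  (T_sub_B : T `<=` B)
  (lambda : G -> k) (lambda_dominant : dominant T B lambda)
  (L : gmodule G) (L_simple : simple_comodule L)
  (L_highest : has_highest_weight T B L lambda)
  (I : gmodule G) (iota : {linear L -> I}) (I_env : injective_envelope iota)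
  (d : Order.disp_t) (J : preorderType d) (J_directed : directed J)
  (X : direct_system (coord_coalgebra G) J)
  (X_findim : forall j : J, finite_dimensional (X j))
  (inj : forall j : J, {linear X j -> I}) (I_lim : direct_limit inj) :
  (exists (P : contramodule (coord_coalgebra G))
          (phi : {linear P -> dual_contramodule L}),
      projective_cover phi) /\
  (exists (Q : contramodule (coord_coalgebra G))
          (proj : forall j : J, {linear Q -> dual_system X j}),
      inverse_limit proj) /\
  (forall (P : contramodule (coord_coalgebra G))
          (phi : {linear P -> dual_contramodule L})
          (Q : contramodule (coord_coalgebra G))
          (proj : forall j : J, {linear Q -> dual_system X j}),
      projective_cover phi -> inverse_limit proj -> contra_iso P Q).
Proof.
(* The dual of [I] is one such cover and one such limit; arbitrary ones are compared with it. *)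
have cover : projective_cover (dual_map iota).
  split; first exact: dual_envelope_projective I_env.
  exact/(dual_envelope_superfluous I_env)/simple_finite_dimensional.
have limit := dual_inverse_limit I_lim.
split; [|split].
- by exists (dual_contramodule I), (dual_map iota).
- by exists (dual_contramodule I), (fun j => dual_map (inj j)).
move=> P phi Q proj phi_cover proj_limit.
apply: contra_iso_trans (projective_cover_unique phi_cover cover) _.
exact: inverse_limit_unique limit proj_limit.
Qed.
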